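(* Let $\sigma>0$. Assume $\mathbb E_v(V_t)<\infty$ for all $t\ge0$, $r>\psi(1)$, and that the process $(Y_t)_{t\ge0}$ is of class $D$. Suppose that the function $\mathcal G$ is continuous at $x=0$. 1. If $\mathcal G$ has a left derivative $\mathcal G'(0^-)$ at $x=0$, then $\mathcal L$ has a left derivative $\mathcal L'(0^-)$ at $x=0$. 2. If moreover $\mathcal G'(0^-)\ne0$, then $B_c\in\left[\tilde b,\frac{(r-\psi(1))c}{r\alpha}\right[$, where $$\tilde b=\frac{(r-\psi(1))c}{r\alpha}\lim_{x\uparrow0}\frac{1-\mathcal L(x)}{1-\mathcal G(x)}.$$ 3. If moreover $g(\cdot,\tilde b)$ is strictly convex on $]\tilde b,\infty[$, then the smallest optimal stopping time of the problem $$s(v)=\sup_{\tau\in\Delta}\ \mathbb E_v\left[e^{-r\tau}\left(\frac{-\alpha V_\tau}{r-\psi(1)}+\frac{c}{r}\right)\mathbf 1_{\{\tau<\infty\}}\right]$$ is $\tau^*(c)=\inf\{t\ge0:\ V_t\le B_c\}$ with $B_c=\tilde b$.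
   Context: $X$ is a real-valued Lévy process with $X_0=0$ on a filtered probability space $(\Omega,\mathcal F,(\mathcal F_t)_{t\ge0},\mathbb P)$, with characteristic function $\mathbb E(e^{i\lambda X_t})=e^{-t\Psi(\lambda)}$, $\Psi(\lambda)=-im\lambda+\frac{\sigma^2}{2}\lambda^2+\int_{\mathbb R}(1-e^{i\lambda x}+i\lambda x\mathbf 1_{|x|<1})\,\Pi(dx)$, where $m\in\mathbb R$ and $\Pi$ is a measure on $\mathbb R\setminus\{0\}$ with $\int(1\wedge x^2)\Pi(dx)<\infty$. For $v>0$, $V=ve^X$, and $\mathbb P_v,\mathbb E_v$ denote probability and expectation given $V_0=v$. When $\mathbb E_v(V_t)<\infty$ for all $t$, $\psi(1)$ is the real number defined by $\mathbb E(e^{X_t})=e^{t\psi(1)}$. The constants satisfy $r>0$, $\alpha>0$, $c>0$. $\mathcal F^V$ is the right-continuous complete filtration generated by $V$, and $\Delta$ is the set of $\mathcal F^V$-stopping times (possibly infinite). $Y_t=e^{-rt}\left(\frac{-\alpha V_t}{r-\psi(1)}+\frac{c}{r}\right)$; being of class $D$ means that $\{Y_\tau:\tau\in\Delta\}$ is uniformly integrable, with $Y_\infty=0$. For $x\in\mathbb R$ let $\bar\tau_x=\inf\{t\ge0: X_t\le x\}$ and $$\mathcal L(x)=\mathbb E\left[e^{-r\bar\tau_x}\mid X_0=0\right],\qquad \mathcal G(x)=\mathbb E\left[e^{-r\bar\tau_x+X_{\bar\tau_x}}\mid X_0=0\right],$$ the integrands being $0$ on $\{\bar\tau_x=\infty\}$.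 For $v>0$ and $b\in\left]0,\frac{(r-\psi(1))c}{r\alpha}\right[$, $$g(v,b)=\mathbb E_v\left[e^{-r\tau_b}\left(\frac{-\alpha V_{\tau_b}}{r-\psi(1)}+\frac cr\right)\right]=\frac{-\alpha v}{r-\psi(1)}\,\mathcal G\left(\ln\frac bv\right)+\frac cr\,\mathcal L\left(\ln\frac bv\right),\quad \tau_b=\inf\{t\ge0:V_t\le b\}.$$ A stopping time is optimal if it attains the supremum $s(v)$; the smallest optimal stopping time is the optimal $\tau^*$ with $\mathbb P_v(\tau^*\le\tau)=1$ for every optimal $\tau$. Under the stated assumptions ($\sigma>0$, integrability, $r>\psi(1)$, class $D$) the smallest optimal stopping time is of the form $\inf\{t\ge0:V_t\le B_c\}$ for some $B_c>0$ not depending on $v$; $B_c$ denotes this threshold, and $g(\cdot,B_c)=s(\cdot)$. *)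

(* Defs.v *)
From HB Require Import structures.
From mathcomp Require Import all_boot all_order all_algebra.
From mathcomp Require Import complex.
From mathcomp Require Import all_classical all_reals all_analysis.

Set Implicit Arguments.
Unset Strict Implicit.
Unset Printing Implicit Defensive.

Import Order.TTheory GRing.Theory Num.Theory.
Import numFieldNormedType.Exports.

Local Open Scope classical_set_scope.
Local Open Scope ring_scope.
Local Open Scope complex_scope.

(* A real-valued process is a map [X : R -> Omega -> R]; time is [0, +oo[ and
   the values at negative times play no role.  "Almost surely" is [{ae P, _}],
   which for a set outside the sigma-algebra refers to the completion of P. *)

Definition cexp (R : realType) (z : R[i]) : R[i] :=
  (expR (complex.Re z))%:C *
  (cos (complex.Im z) +i* sin (complex.Im z)).

Definition Cintegral d (T : measurableType d) (R : realType)
    (mu : {measure set T -> \bar R}) (f : T -> R[i]) : R[i] :=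
  (\int[mu]_x complex.Re (f x)) +i* (\int[mu]_x complex.Im (f x)).

Definition char_fun d (Omega : measurableType d) (R : realType)
    (P : probability Omega R) (Z : Omega -> R) (lambda : R) : R[i] :=
  Cintegral P (fun w => cexp ('i * (lambda * Z w)%:C)).

(* A measure on R \ {0} is a measure on R that does not charge 0. *)
Definition levy_measure (R : realType) (Pi : {measure set R -> \bar R}) : Prop :=
  Pi [set 0] = 0%E /\
  (\int[Pi]_x (Num.min 1 (x ^+ 2))%:E < +oo)%E.

Definition levy_exponent (R : realType) (m sigma : R)
    (Pi : {measure set R -> \bar R}) (lambda : R) : R[i] :=
  - ('i * (m * lambda)%:C) + (sigma ^+ 2 / 2 * lambda ^+ 2)%:C
  + Cintegral Pi (fun x : R => 1 - cexp ('i * (lambda * x)%:C)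
      + 'i * (lambda * x * (`|x| < 1)%R%:R)%:C).

Definition filtration d (Omega : measurableType d) (R : realType)
    (F : R -> set (set Omega)) : Prop :=
  [/\ forall t : R, 0 <= t -> sigma_algebra setT (F t),
      forall t : R, 0 <= t -> F t `<=` measurable &
      forall s t : R, 0 <= s -> s <= t -> F s `<=` F t].

Definition cadlag (R : realType) (f : R -> R) : Prop :=
  (forall t : R, 0 <= t -> f @ t^'+ --> f t) /\
  (forall t : R, 0 < t -> cvg (f @ t^'-)).

Record levy_process d (Omega : measurableType d) (R : realType)
    (P : probability Omega R) (F : R -> set (set Omega))
    (X : R -> Omega -> R) : Prop := LevyProcess {
  levy_adapted : forall (t : R) (B : set R), 0 <= t -> measurable B ->
    F t (X t @^-1` B) ;
  levy_start : {ae P, forall w, X 0 w = 0} ;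
  levy_independent_increments : forall (s t : R) (A : set Omega) (B : set R),
    0 <= s -> s <= t -> F s A -> measurable B ->
    (P (A `&` (fun w => X t w - X s w)%R @^-1` B) =
     P A * P ((fun w => X t w - X s w)%R @^-1` B))%E ;
  levy_stationary_increments : forall (s t : R) (B : set R),
    0 <= s -> s <= t -> measurable B ->
    P ((fun w => X t w - X s w) @^-1` B) = P (X (t - s) @^-1` B) ;
  levy_cadlag : {ae P, forall w, cadlag (X ^~ w)} }.

Definition has_levy_triplet d (Omega : measurableType d) (R : realType)
    (P : probability Omega R) (X : R -> Omega -> R) (m sigma : R)
    (Pi : {measure set R -> \bar R}) : Prop :=
  levy_measure Pi /\
  forall t lambda : R, 0 <= t ->
    char_fun P (X t) lambda = cexp (- (t%:C * levy_exponent m sigma Pi lambda)).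

(* [psi1] is psi(1), where E(e^{X_t}) = e^{t psi(1)}. *)
Definition laplace_exponent1 d (Omega : measurableType d) (R : realType)
    (P : probability Omega R) (X : R -> Omega -> R) (psi1 : R) : Prop :=
  forall t : R, 0 <= t -> ('E_P[fun w => expR (X t w)] = (expR (t * psi1))%:E)%E.

(* As X starts at 0 under P, P_v and E_v are realised on the single space
   (Omega, P) as the law and expectation of functionals of [exp_process X v]. *)
Definition exp_process (Omega : Type) (R : realType) (X : R -> Omega -> R)
  (v : R) : R -> Omega -> R := fun t w => v * expR (X t w).

Definition generated_filtration (Omega : Type) (R : realType)
    (V : R -> Omega -> R) (t : R) : set (set Omega) :=
  <<s [set A | exists s (B : set R),
         [/\ 0 <= s, s <= t, measurable B & A = V s @^-1` B]] >>.

Definition usual_filtration d (Omega : measurableType d) (R : realType)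
    (P : probability Omega R) (V : R -> Omega -> R) (t : R) :
    set (set Omega) :=
  \bigcap_(s in [set s : R | t < s])
    <<s generated_filtration V s `|` [set N | P.-negligible N] >>.

Definition stopping_time (Omega : Type) (R : realType)
    (F : R -> set (set Omega)) (tau : Omega -> \bar R) : Prop :=
  (forall w, (0 <= tau w)%E) /\
  (forall t : R, 0 <= t -> F t [set w | (tau w <= t%:E)%E]).

Definition Delta d (Omega : measurableType d) (R : realType)
    (P : probability Omega R) (V : R -> Omega -> R) :
    set (Omega -> \bar R) :=
  [set tau | stopping_time (usual_filtration P V) tau].

Definition hitting_time (Omega : Type) (R : realType) (V : R -> Omega -> R)
    (b : R) (w : Omega) : \bar R :=
  ereal_inf [set t%:E | t in [set t : R | 0 <= t /\ V t w <= b]].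

(* Y_tau, with the convention Y_oo = 0. *)
Definition stopped (Omega : Type) (R : realType) (Y : R -> Omega -> R)
    (tau : Omega -> \bar R) (w : Omega) : R :=
  if tau w is t%:E then Y t w else 0.

Definition uniformly_integrable d (Omega : measurableType d) (R : realType)
    (P : probability Omega R) (H : set (Omega -> R)) : Prop :=
  forall e : R, 0 < e -> exists K : R, forall f, H f ->
    (\int[P]_(w in [set w | K < `|f w|]%R) `|f w|%:E <= e%:E)%E.

Definition class_D d (Omega : measurableType d) (R : realType)
    (P : probability Omega R) (V Y : R -> Omega -> R) : Prop :=
  uniformly_integrable P [set stopped Y tau | tau in Delta P V].

Definition discounted_payoff (Omega : Type) (R : realType)
    (r alpha c psi1 : R) (V : R -> Omega -> R) : R -> Omega -> R :=
  fun t w => expR (- r * t) * (- alpha * V t w / (r - psi1) + c / r).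

(* Takes values in \bar R; the payoff is bounded above by c / r, so this is
   never an indeterminate difference of infinities. *)
Definition reward d (Omega : measurableType d) (R : realType)
    (P : probability Omega R) (r alpha c psi1 : R) (V : R -> Omega -> R)
    (tau : Omega -> \bar R) : \bar R :=
  ('E_P[stopped (discounted_payoff r alpha c psi1 V) tau])%E.

Definition value d (Omega : measurableType d) (R : realType)
    (P : probability Omega R) (r alpha c psi1 : R) (V : R -> Omega -> R) :
    \bar R :=
  ereal_sup [set reward P r alpha c psi1 V tau | tau in Delta P V].

Definition optimal d (Omega : measurableType d) (R : realType)
    (P : probability Omega R) (r alpha c psi1 : R) (V : R -> Omega -> R)
    (tau : Omega -> \bar R) : Prop :=
  Delta P V tau /\ reward P r alpha c psi1 V tau = value P r alpha c psi1 V.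

Definition smallest_optimal d (Omega : measurableType d) (R : realType)
    (P : probability Omega R) (r alpha c psi1 : R) (V : R -> Omega -> R)
    (tau : Omega -> \bar R) : Prop :=
  optimal P r alpha c psi1 V tau /\
  forall tau', optimal P r alpha c psi1 V tau' ->
    {ae P, forall w, (tau w <= tau' w)%E}.

Definition optimal_threshold d (Omega : measurableType d) (R : realType)
    (P : probability Omega R) (r alpha c psi1 : R) (X : R -> Omega -> R)
    (B : R) : Prop :=
  0 < B /\ forall v : R, 0 < v ->
    smallest_optimal P r alpha c psi1 (exp_process X v)
      (hitting_time (exp_process X v) B).

Definition calL d (Omega : measurableType d) (R : realType)
    (P : probability Omega R) (r : R) (X : R -> Omega -> R) (x : R) : R :=
  fine ('E_P[stopped (fun t _ => (expR (- r * t))%R) (hitting_time X x)])%E.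

Definition calG d (Omega : measurableType d) (R : realType)
    (P : probability Omega R) (r : R) (X : R -> Omega -> R) (x : R) : R :=
  fine ('E_P[stopped (fun t w => (expR (- r * t + X t w))%R) (hitting_time X x)])%E.

(* g(v, b); it equals
   - alpha v / (r - psi(1)) G(ln (b / v)) + c / r L(ln (b / v)). *)
Definition threshold_reward d (Omega : measurableType d) (R : realType)
    (P : probability Omega R) (r alpha c psi1 : R) (X : R -> Omega -> R)
    (v b : R) : R :=
  fine (reward P r alpha c psi1 (exp_process X v)
          (hitting_time (exp_process X v) b)).

Definition btilde d (Omega : measurableType d) (R : realType)
    (P : probability Omega R) (r alpha c psi1 : R) (X : R -> Omega -> R) : R :=
  (r - psi1) * c / (r * alpha) *
  lim ((1 - calL P r X x) / (1 - calG P r X x) @[x --> 0^'-]).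

Definition is_left_derivative (R : realType) (f : R -> R) (x l : R) : Prop :=
  (f (x + h) - f x) / h @[h --> 0^'-] --> l.

Definition strictly_convex_on (R : realType) (A : set R) (f : R -> R) : Prop :=
  forall x y t : R, A x -> A y -> x != y -> 0 < t -> t < 1 ->
    f (t * x + (1 - t) * y) < t * f x + (1 - t) * f y.

(* Main.v *)
Require Import Defs.
From HB Require Import structures.
From mathcomp Require Import all_boot all_order all_algebra.
From mathcomp Require Import complex.
From mathcomp Require Import all_classical all_reals all_analysis.
From mathcomp Require Import measurable_realfun ring lra.

(* Write [a = alpha / (r - psi1)] and [K = c / r], so that the reward of [tau_b] at
   [v] is [g(v, b) = - a v G(ln (b / v)) + K L(ln (b / v))].  Every hitting time
   [tau_x] of [X] is a competitor at every [v], with a reward affine in [v], so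
   the value [s = g(., Bc)] is convex.  Its right derivative at [Bc] therefore
   exists, and along [v = Bc e^{-x}] it gives the left derivative of [L] at [0]
   from that of [G].  The inequality [s(v) >= K - a v] near [Bc] reads
   [K (1 - L) <= a v (1 - G)], whose limit is [bt <= Bc]; the strict bound on
   [Bc] holds because [sigma > 0] makes [X] negative with positive probability,
   hence the value positive.  By its definition [bt] satisfies smooth fit, so
   under strict convexity [g(., bt)] lies strictly above the payoff right of
   [bt], which is impossible on ]bt, Bc[, where [s] is the payoff. *)

Set Implicit Arguments.
Unset Strict Implicit.
Unset Printing Implicit Defensive.

Import Order.TTheory GRing.Theory Num.Theory.
Import numFieldNormedType.Exports.

Local Open Scope classical_set_scope.
Local Open Scope ring_scope.

(** * Integrals and measurability up to null sets *)

(* Hitting times are measurable only for the completion of the probability, so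
   the stopped payoffs need not be measurable; their integrals (suprema over the
   simple functions below them) are still insensitive to null sets. *)
Section NullSets.
Context d (T : measurableType d) (R : realType) (mu : {measure set T -> \bar R}).
Import HBNNSimple.

(** A simple function below [f] keeps its integral when cut to 0 on [N], and is then below the
    restriction of [f]; conversely, a simple function below that restriction is below [f], since [f]
    is nonnegative. *)
Lemma ge0_integral_setC_null (f : T -> \bar R) (N : set T) :
  measurable N -> mu N = 0%E -> (forall x, 0 <= f x)%E ->
  (\int[mu]_x f x = \int[mu]_(x in ~` N) f x)%E.
Proof.
move=> mN N0 f0; apply/eqP; rewrite eq_le; apply/andP; split.
- rewrite [leLHS]ge0_integralTE// [leRHS]ge0_integralE//.
  apply: ge_ereal_sup => /= _ [h /= hf <-].
  have mNC := measurableC mN.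
  have -> : sintegral mu h = (\int[mu]_(x in ~` N) (h x)%:E)%E.
    rewrite -(setTD N) -ge0_negligible_integral //.
    + by rewrite integral_nnsfun ?patch_setT.
    + by apply/measurable_EFinP.
    + by move=> x _; rewrite lee_fin; exact: fun_ge0.
  rewrite ge0_integralE; last by move=> x _; rewrite lee_fin; exact: fun_ge0.
  apply: le_ereal_sup => _ [k /= kh <-]; exists k => // x.
  apply: le_trans (kh x) _; rewrite /patch; case: ifP => // _; exact: hf.
- rewrite [leLHS]ge0_integralE// [leRHS]ge0_integralTE//.
  apply: le_ereal_sup => _ [k /= kh <-]; exists k => // x.
  by apply: le_trans (kh x) _; rewrite /patch; case: ifP.
Qed.

Lemma integral_eq_off_null (f g : T -> \bar R) (N : set T) :
  measurable N -> mu N = 0%E -> (forall x, ~ N x -> f x = g x) ->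
  (\int[mu]_x f x = \int[mu]_x g x)%E.
Proof.
move=> mN N0 fg; rewrite integralE [RHS]integralE.
have fgN : {in ~` N, f =1 g} by move=> x; rewrite inE => /fg.
congr (_ - _)%E; rewrite !(ge0_integral_setC_null mN N0)//;
  by apply: eq_integral => x xN; rewrite !(funeposE, funenegE) fgN.
Qed.

(** This is measurability for the completion of [mu]: such a set is a measurable set together with a
    subset of a null set. *)
Definition ae_measurable (A : set T) :=
  exists N, [/\ measurable N, mu N = 0%E & measurable (A `\` N)].

Lemma null_bigcup (N : (set T)^nat) :
  (forall n, measurable (N n) /\ mu (N n) = 0%E) ->
  measurable (\bigcup_n N n) /\ mu (\bigcup_n N n) = 0%E.
Proof.
move=> HN; have mU : measurable (\bigcup_n N n).
  by apply: bigcupT_measurable => n; case: (HN n).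
split=> //; apply/negligibleP => //; apply: negligible_bigcup => n.
by apply/negligibleP; case: (HN n).
Qed.

Lemma ae_measurable_common_null (A : (set T)^nat) :
  (forall n, ae_measurable (A n)) ->
  exists N, [/\ measurable N, mu N = 0%E & forall n, measurable (A n `\` N)].
Proof.
move=> /choice[N HN]; have [mU U0] : measurable (\bigcup_n N n) /\
    mu (\bigcup_n N n) = 0%E by apply: null_bigcup => n; case: (HN n).
exists (\bigcup_n N n); split=> // n; have [_ _ AN] := HN n.
suff -> : A n `\` \bigcup_n N n = (A n `\` N n) `\` \bigcup_n N n.
  exact: measurableD.
apply/seteqP; split=> x [] => [Ax Nx|[Ax _] Nx] //.
by split=> //; split=> // Nnx; apply: Nx; exists n.
Qed.

Lemma sigma_algebra_ae_measurable : sigma_algebra setT ae_measurable.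
Proof.
split.
- by exists set0; split=> //; rewrite set0D.
- move=> A [N [mN N0 mA]]; exists N; split=> //.
  suff -> : setT `\` A `\` N = ~` N `\` (A `\` N).
    by apply: measurableD => //; exact: measurableC.
  apply/seteqP; split=> x /=; first by move=> [[_ nA] nN]; split=> // -[].
  by move=> [nN nA]; split=> //; split=> // Ax; exact: nA.
- move=> A /ae_measurable_common_null[N [mN N0 mA]]; exists N; split=> //.
  by rewrite setDE setI_bigcupl; exact: bigcupT_measurable.
Qed.

(** The sets with rational [t] determine [tau] and are countably many, so one null set absorbs all
    corrections. *)
Lemma ae_measurable_time (tau : T -> \bar R) :
  (forall t : R, ae_measurable [set w | (tau w <= t%:E)%E]) ->
  exists N, [/\ measurable N, mu N = 0%E &
    measurable_fun setT (fun w => if w \in N then +oo%E else tau w)].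
Proof.
(* [q] enumerates the rationals; a code that decodes to nothing gives 0, a harmless repetition. *)
move=> mtau; pose q (n : nat) : R := ratr (odflt 0%R (unpickle n : option rat)).
have [|N [mN N0 mAN]] := @ae_measurable_common_null
  (fun n => [set w | (tau w <= (q n)%:E)%E]); first by move=> n; exact: mtau.
exists N; split=> // _.
apply: (measurability _ (ErealGenCInfty.measurableE R)) => //.
move=> _ [_ [x ->] <-]; rewrite setTI.
rewrite [X in measurable X](_ : _ = ~` (\bigcup_(n in [set n | q n < x])
   ([set w | (tau w <= (q n)%:E)%E] `\` N))).
  by apply: measurableC; exact: bigcup_measurable.
apply/seteqP; split=> w /=; rewrite in_itv /= andbT.
- move=> xw [n /= qx [/= tq wN]].
  move: xw; rewrite ifF; last by apply/negbTE; rewrite notin_setE.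
  by apply/negP; rewrite -ltNge; apply: le_lt_trans tq _; rewrite lte_fin.
- move=> H; case: ifPn => [|wN]; first by rewrite leey.
  rewrite leNgt; apply/negP => taux; apply: H.
  have [p p1 p2] : exists2 p : rat, (tau w <= (ratr p)%:E)%E & ratr p < x.
    move: taux; case: (tau w) => [s| |] //.
    + rewrite lte_fin => /rat_in_itvoo[p]; rewrite in_itv /= => /andP[sp px].
      by exists p => //; rewrite lee_fin ltW.
    + move=> _; have /rat_in_itvoo[p] : x - 1 < x by lra.
      by rewrite in_itv /= => /andP[_ px]; exists p => //; rewrite leNye.
  exists (pickle p); first by rewrite /q /= pickleK.
  by split; [rewrite /q /= pickleK|rewrite -notin_setE].
Qed.

(** Stopping at the next grid time after [tau] involves only countably many variables [Z t];
    refining the grid, right continuity passes to the limit. *)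
Lemma measurable_stopped (Z : R -> T -> R) (tau : T -> \bar R) :
  (forall t, 0 <= t -> measurable_fun setT (Z t)) ->
  measurable_fun setT tau -> (forall w, 0 <= tau w)%E ->
  (forall w t, tau w = t%:E -> Z ^~ w @ t^'+ --> Z t w) ->
  measurable_fun setT (stopped Z tau).
Proof.
move=> mZ mtau tau0 Zr.
(* The first grid point of mesh [1 / n.+1] strictly after [t]; strictness matters because [t^'+]
   excludes [t] itself. *)
pose s (n : nat) (t : R) := (Num.truncn (n.+1%:R * t)).+1%:R / n.+1%:R : R.
have step n : measurable_fun setT (stopped (fun t w => Z (s n t) w) tau).
  move=> _ B mB; rewrite setTI.
  rewrite [X in measurable X](_ : _ =
    (tau @^-1` [set +oo%E] `&` (fun=> 0 : R) @^-1` B) `|`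
    \bigcup_k ((tau @^-1` `[ (k%:R / n.+1%:R)%:E, (k.+1%:R / n.+1%:R)%:E [) `&`
       Z (k.+1%:R / n.+1%:R) @^-1` B)).
    have m0 : measurable_fun [set: T] (fun=> 0 : R) by exact: measurable_cst.
    apply: measurableU.
      apply: measurableI.
        by rewrite -[X in measurable X]setTI; exact: mtau (emeasurable_set1 _).
      by rewrite -[X in measurable X]setTI; exact: m0.
    apply: bigcupT_measurable => j; apply: measurableI.
      by rewrite -[X in measurable X]setTI; exact: mtau (emeasurable_itv _).
    rewrite -[X in measurable X]setTI; apply: mZ => //.
  have P (t : R) j : 0 <= t ->
      (j%:R / n.+1%:R <= t < j.+1%:R / n.+1%:R) = (Num.truncn (n.+1%:R * t) == j).
    move=> t0; rewrite truncn_eq ?mulr_ge0// ler_pdivrMr// ltr_pdivlMr//.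
    by rewrite mulrC.
  apply/seteqP; split=> w /=; rewrite /stopped.
  + case E : (tau w) (tau0 w) => [t| |] //=; last by move=> _ H; left.
    rewrite lee_fin => t0 Bt; right.
    exists (Num.truncn (n.+1%:R * t)) => //; split=> //=.
    by rewrite E in_itv/= lee_fin lte_fin P.
  + move=> [[-> //]|[j _ [/=]]]; rewrite in_itv /=.
    case E : (tau w) (tau0 w) => [t| |] //=; last by move=> _ /andP[_]; rewrite ltNge leey.
    by rewrite !lee_fin lte_fin => t0; rewrite P// /s => /eqP ->.
apply: (measurable_fun_cvg step) => w _.
rewrite /stopped; case E : (tau w) (tau0 w) => [t| |] //=; last first.
  by move=> _; exact: cvg_cst.
rewrite lee_fin => t0.
have st n : t < s n t by rewrite /s ltr_pdivlMr// mulrC truncnS_gt.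
have sle n : s n t <= t + n.+1%:R^-1.
  rewrite /s ler_pdivrMr// mulrDl mulVf// mulrC -natr1 lerD2r.
  by rewrite mulrC truncn_le mulr_ge0.
have scvg : s ^~ t @ \oo --> t.
  apply: (@squeeze_cvgr _ _ _ _ (fun=> t) (fun n => t + n.+1%:R^-1)).
  - by near=> n; rewrite ltW//=.
  - exact: cvg_cst.
  - rewrite -[X in _ --> X]addr0; apply: cvgD; first exact: cvg_cst.
    exact: cvg_harmonic.
apply: (cvg_trans _ (Zr _ _ E)).
have st' : s ^~ t @ \oo --> t^'+.
  move=> A nA; have : \forall n \near \oo, t < s n t -> A (s n t) by exact: scvg nA.
  by apply: filterS => n /=; apply; exact: st.
by move=> A ZA; exact: st' ZA.
Unshelve. all: by end_near. Qed.

End NullSets.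

(** * Hitting times of half-lines and their measurable versions *)

Section HittingTimes.
Context d (Omega : measurableType d) (R : realType) (P : probability Omega R).
Implicit Types (X : R -> Omega -> R).

Lemma exp_process_le X (v b t : R) w : 0 < v -> 0 < b ->
  (exp_process X v t w <= b) = (X t w <= ln (b / v)).
Proof.
move=> v0 b0; rewrite -[in RHS](expRK (X t w)) ler_ln ?posrE ?expR_gt0 ?divr_gt0//.
by rewrite ler_pdivlMr// mulrC.
Qed.

Lemma hitting_time_exp_process X (v b : R) : 0 < v -> 0 < b ->
  hitting_time (exp_process X v) b = hitting_time X (ln (b / v)).
Proof.
move=> v0 b0; apply/funext => w; rewrite /hitting_time; congr ereal_inf.
by apply/seteqP; split=> _ [t /= [t0 Xt] <-]; exists t => //=; split=> //;
  move: Xt; rewrite exp_process_le.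
Qed.

Lemma hitting_time_ge0 X (x : R) w : (0 <= hitting_time X x w)%E.
Proof. by apply: le_ereal_inf_tmp => _ [t /= [t0 _] <-]; rewrite lee_fin. Qed.

Lemma hitting_time_le X (x t : R) w : 0 <= t -> X t w <= x ->
  (hitting_time X x w <= t%:E)%E.
Proof. by move=> t0 Xt; apply: ereal_inf_lbound; exists t. Qed.

Lemma hitting_time_start X (x : R) w : X 0 w <= x -> hitting_time X x w = 0%E.
Proof.
move=> Xx; apply/eqP; rewrite eq_le hitting_time_ge0 andbT.
exact: hitting_time_le.
Qed.

(** If [X t w] exceeded [x], right continuity would keep the path above [x] on a short interval
    after [t], where the infimum requires a hit. *)
Lemma hitting_time_attained X (x t : R) w :
  X ^~ w @ t^'+ --> X t w -> hitting_time X x w = t%:E -> X t w <= x.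
Proof.
move=> Xr Et; rewrite leNgt; apply/negP => xX.
have /Xr : nbhs (X t w) [set y | x < y] by exact: lt_nbhsr.
rewrite nbhs_simpl /= => -[e /= e0 He].
have /ereal_inf_lt[_ [s [/= s0 Xs] <-] ste] : (hitting_time X x w < (t + e)%:E)%E.
  by rewrite Et lte_fin ltrDl.
have ts : t <= s by rewrite -lee_fin -Et; exact: hitting_time_le.
move: ts; rewrite le_eqVlt => /predU1P[ts|ts].
  by move: Xs; rewrite -ts leNgt xX.
have : x < X s w.
  apply: He => //=; rewrite ltr0_norm ?subr_lt0//.
  by move: ste; rewrite lte_fin; lra.
by rewrite ltNge Xs.
Qed.

(** The intersection over later times lies in the completed sigma-algebra at time [t + 1], whose
    generators are all measurable for the completion. *)
Lemma usual_filtration_ae_measurable X (t : R) A :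
  (forall t, 0 <= t -> measurable_fun setT (X t)) -> 0 <= t ->
  usual_filtration P X t A -> ae_measurable P A.
Proof.
move=> mX t0 /(_ (t + 1)) HA.
have {HA} : <<s generated_filtration X (t + 1) `|` [set N | P.-negligible N] >> A.
  by apply: HA => /=; lra.
move: A; apply: smallest_sub; first exact: sigma_algebra_ae_measurable.
have meas A : measurable A -> ae_measurable P A.
  by move=> mA; exists set0; split=> //; rewrite setD0.
move=> A [|[N [mN N0 AN]]]; last first.
  exists N; split=> //; suff -> : A `\` N = set0 by [].
  by apply/seteqP; split=> w //= -[/AN].
move=> HA; apply: meas; move: A HA; apply: smallest_sub.
  exact: sigma_algebra_measurable.
move=> _ [s [B [s0 _ mB ->]]]; rewrite -[X in measurable X]setTI.
exact: mX.
Qed.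

Definition regular_path X (w : Omega) :=
  X 0 w = 0 /\ forall t, 0 <= t -> X ^~ w @ t^'+ --> X t w.

Lemma levy_process_measurable (F : R -> set (set Omega)) X :
  filtration F -> levy_process P F X ->
  forall t, 0 <= t -> measurable_fun setT (X t).
Proof.
move=> [_ FM _] LX t t0 _ B mB; rewrite setTI; apply: (FM t) => //.
exact: (levy_adapted LX).
Qed.

Lemma levy_process_regular (F : R -> set (set Omega)) X :
  levy_process P F X -> {ae P, forall w, regular_path X w}.
Proof.
move=> LX; have := levy_start LX; apply: filterS2 (levy_cadlag LX).
by move=> w [Xr _] X0; split.
Qed.

(** [l] and [g] are measurable versions of the discount factor at the hitting time and of its
    product with [expR] of the stopped process. The bound on [g] holds because the path is at most
    [x] when it hits. *)
Lemma hitting_time_representation X (x r : R) : 0 < r ->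
  (forall t, 0 <= t -> measurable_fun setT (X t)) ->
  {ae P, forall w, regular_path X w} ->
  (forall t : R, ae_measurable P [set w | (hitting_time X x w <= t%:E)%E]) ->
  exists N (l g : Omega -> R),
  [/\ measurable N, P N = 0%E, measurable_fun setT l & measurable_fun setT g] /\
  [/\ forall w, 0 <= l w <= 1, forall w, 0 <= g w <= expR x * l w,
    0 <= x -> forall w, ~ N w -> l w = 1 /\ g w = 1,
    forall w, ~ N w -> forall t, 0 <= t -> X t w <= x -> expR (- r * t) <= l w &
    forall w, ~ N w -> forall a b,
      stopped (fun t w => expR (- r * t) * (a * expR (X t w) + b))
        (hitting_time X x) w = a * g w + b * l w].
Proof.
move=> r0 mX [N0 [mN0 PN0 HN0]] /ae_measurable_time[N1 [mN1 PN1 mtau1]].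
pose N := N0 `|` N1.
have mN : measurable N by exact: measurableU.
have PN : P N = 0%E.
  by apply/negligibleP => //; apply: negligibleU; apply/negligibleP.
(* Infinity on the paths that are irregular and on the null set that spoils measurability: [l] and
   [g] then vanish there and their bounds hold everywhere. *)
pose tau w := if w \in N0 then +oo%E else
  if w \in N1 then +oo%E else hitting_time X x w.
have mtau : measurable_fun setT tau.
  apply: measurable_fun_ifT => //.
  by apply: (measurable_fun_bool true); rewrite setTI preimage_mem_true.
have tau_ge0 w : (0 <= tau w)%E.
  by rewrite /tau; do 2 case: ifP => // _; exact: hitting_time_ge0.
have tauE w : ~ N w -> tau w = hitting_time X x w.
  by move=> /not_orP[w0 w1]; rewrite /tau !memNset.
have tau_fin w t : tau w = t%:E ->
    [/\ 0 <= t, ~ N w, hitting_time X x w = t%:E & regular_path X w].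
  rewrite /tau; case: ifPn => //; rewrite notin_setE => w0.
  case: ifPn => //; rewrite notin_setE => w1 tw; split=> //.
  - by rewrite -lee_fin -tw hitting_time_ge0.
  - by case.
  - by apply: contrapT => Xw; apply: w0; exact: HN0.
have mXtau : measurable_fun setT (stopped X tau).
  apply: measurable_stopped => // w t /tau_fin[t0 _ _ [_]]; exact.
pose l := stopped (fun t _ => expR (- r * t)) tau.
have ml : measurable_fun setT l.
  apply: measurable_stopped => // w t _.
  apply: cvg_at_right_filter.
  have c : continuous (fun t : R => expR (- r * t)).
    move=> y; apply: continuous_comp; last exact: continuous_expR.
    exact: mulrl_continuous.
  exact: c.
(* Where [tau] is infinite the exponential is 1, and the factor [l] makes [g] vanish. *)
pose g w := l w * expR (stopped X tau w).
exists N, l, g; split; split=> //.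
- by apply: measurable_funM => //; exact: measurableT_comp.
- move=> w; rewrite /l /stopped; case: (tau w) (tau_fin w) => [t||] //=;
    rewrite ?lexx ?ler01//.
  move=> /(_ t erefl)[t0 _ _ _]; rewrite expR_ge0 -expR0 ler_expR; nra.
- move=> w; rewrite /g /l /stopped; case: (tau w) (tau_fin w) => [t||] //=;
    rewrite ?mul0r ?mulr0 ?lexx//.
  move=> /(_ t erefl)[t0 _ ht [_ Xr]].
  rewrite mulr_ge0 ?expR_ge0//= mulrC ler_wpM2r ?expR_ge0// ler_expR.
  exact: hitting_time_attained (Xr _ t0) ht.
- move=> x0 w Nw; have [X0 _] : regular_path X w.
    by apply: contrapT => Xw; apply: Nw; left; exact: HN0.
  rewrite /g /l /stopped tauE// hitting_time_start ?X0//=.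
  by rewrite X0 mulr0 expR0 mulr1.
- move=> w Nw t t0 Xt; have := hitting_time_le t0 Xt.
  have := hitting_time_ge0 X x w.
  rewrite -tauE// /l /stopped; case: (tau w) => [s||] //=.
  by rewrite !lee_fin => s0 st; rewrite ler_expR; nra.
- move=> w Nw a b; rewrite /g /l /stopped -tauE//.
  by case: (tau w) => [t||]; ring.
Qed.

End HittingTimes.

(** * Rewards of hitting times in terms of [calL] and [calG] *)

Section HittingReward.
Context d (Omega : measurableType d) (R : realType) (P : probability Omega R).

Lemma bounded_integrable (f : Omega -> R) (M : R) :
  measurable_fun setT f -> (forall w, `|f w| <= M) ->
  P.-integrable setT (EFin \o f).
Proof.
move=> mf fM; apply: measurable_bounded_integrable => //.
  exact: le_lt_trans (probability_le1 _ _) (ltry _).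
by exists M; split; [exact: num_real|move=> y My w _; exact: le_trans (fM w) (ltW My)].
Qed.

Lemma hitting_reward (X : R -> Omega -> R) (x r : R) : 0 < r ->
  (forall t, 0 <= t -> measurable_fun setT (X t)) ->
  {ae P, forall w, regular_path X w} ->
  (forall t : R, ae_measurable P [set w | (hitting_time X x w <= t%:E)%E]) ->
  [/\ 0 <= calL P r X x <= 1,
    0 <= calG P r X x <= expR x * calL P r X x,
    0 <= x -> calL P r X x = 1 /\ calG P r X x = 1,
    forall t, 0 <= t -> (0 < P [set w | X t w <= x]%R)%E -> 0 < calL P r X x &
    forall v alpha c psi1,
      reward P r alpha c psi1 (exp_process X v) (hitting_time X x) =
      (- alpha * v / (r - psi1) * calG P r X x + c / r * calL P r X x)%:E].
Proof.
move=> r0 mX Xreg mtau.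
have [N [l [g [[mN PN0 ml mg] [l01 gl start hit rep]]]]] :=
  hitting_time_representation r0 mX Xreg mtau.
have int_l : P.-integrable setT (EFin \o l).
  apply: (bounded_integrable ml (M := 1)) => w.
  by have /andP[? ?] := l01 w; rewrite ger0_norm.
have int_g : P.-integrable setT (EFin \o g).
  apply: (bounded_integrable mg (M := expR x)) => w.
  have /andP[g0 gx] := gl w; rewrite ger0_norm//; apply: le_trans gx _.
  by have /andP[_ ?] := l01 w; rewrite ger_pMr ?expR_gt0.
(* One formula serves three times: [(a, b) = (0, 1)] gives [calL], [(1, 0)] gives [calG], and the
   payoff coefficients give the reward. *)
have E a b : expectation P
      (stopped (fun t w => expR (- r * t) * (a * expR (X t w) + b))
        (hitting_time X x)) = (a * \int[P]_w g w + b * \int[P]_w l w)%:E.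
  rewrite expectation.unlock.
  rewrite (@integral_eq_off_null _ _ _ P _ (fun w => (a * g w + b * l w)%:E) N)//;
    last by move=> w Nw; rewrite rep.
  have Zi k (f : Omega -> R) : P.-integrable setT (EFin \o f) ->
    P.-integrable setT (EFin \o (fun w => k * f w)) 
    by move=> fi; exact: (integrableZl measurableT k fi).
  under eq_integral do rewrite EFinD.
  rewrite (integralD measurableT (Zi a g int_g) (Zi b l int_l)) /=.
  under eq_integral do rewrite EFinM.
  rewrite integralZl//.
  under [X in (_ + X)%E]eq_integral do rewrite EFinM.
  rewrite integralZl// EFinD !EFinM /Rintegral !fineK//;
    exact: integrable_fin_num.
have LE : calL P r X x = \int[P]_w l w.
  rewrite /calL -[RHS]mul1r -[RHS]add0r -(mul0r (\int[P]_w g w)).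
  rewrite -[RHS]/(fine (_ %:E)) -E; congr (fine (expectation _ (stopped _ _))).
  by apply/funext => t; apply/funext => w; rewrite mul0r add0r mulr1.
have GE : calG P r X x = \int[P]_w g w.
  rewrite /calG -[RHS]mul1r -[RHS]addr0 -(mul0r (\int[P]_w l w)).
  rewrite -[RHS]/(fine (_ %:E)) -E; congr (fine (expectation _ (stopped _ _))).
  by apply/funext => t; apply/funext => w; rewrite mul1r addr0 expRD.
have P1 : \int[P]_(w in setT) (1 : R) = 1.
  by rewrite Rintegral_cst// mul1r /= probability_setT.
have int_1 : P.-integrable setT (EFin \o (fun=> 1 : R)).
  by apply: (bounded_integrable (M := 1)) => // w; rewrite normr1.
rewrite LE GE; split.
- rewrite Rintegral_ge0 /=; last by move=> w _; case/andP: (l01 w).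
  by rewrite -P1 le_Rintegral// => w _; case/andP: (l01 w).
- rewrite Rintegral_ge0 /=; last by move=> w _; case/andP: (gl w).
  rewrite -RintegralZl// le_Rintegral//; first exact: (integrableZl measurableT (expR x) int_l).
  by move=> w _; case/andP: (gl w).
- move=> x0; have ae1 (f : Omega -> R) : (forall w, ~ N w -> f w = 1) ->
      \int[P]_w f w = 1.
    move=> f1; rewrite -[RHS]P1 /Rintegral; congr fine.
    by apply: (integral_eq_off_null mN PN0) => w /f1 ->.
  by split; apply: ae1 => w /(start x0)[].
- move=> t t0 Pt; set A := [set w | X t w <= x].
  have mA : measurable A.
    have := mX t t0 measurableT _ (measurable_itv `]-oo, x]).
    by rewrite setTI; congr measurable; apply/seteqP; split=> w /=;
      rewrite in_itv.
  have e0 : 0 < expR (- r * t) by exact: expR_gt0.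
  rewrite -lte_fin /Rintegral fineK; last exact: integrable_fin_num.
  (* Off [N], a path that is at most [x] at time [t] has hit by then, so [l] dominates the discount
     at [t] times an indicator of positive probability. *)
  apply: (@lt_le_trans _ _ (\int[P]_w (expR (- r * t) * \1_(A `\` N) w)%:E)%E).
    under eq_integral do rewrite EFinM.
    rewrite integralZl//; last first.
      apply: (bounded_integrable (M := 1)); first exact/measurable_indic/measurableD.
      by move=> w; rewrite indicE ger0_norm// lern1; case: (_ \in _).
    rewrite integral_indic//; last exact: measurableD.
    rewrite setIT; apply: mule_gt0; first by rewrite lte_fin.
    suff PA : P (A `\` N) = P A by move: Pt; rewrite -PA.
    rewrite measureD//; last exact: le_lt_trans (probability_le1 _ _) (ltry _).
    rewrite (@subset_measure0 _ _ _ P (A `&` N) N) ?sube0//.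
    exact: measurableI.
  apply: ge0_le_integral => //.
  + apply/measurable_EFinP; apply: measurable_funM => //.
    exact/measurable_indic/measurableD.
  + by apply/measurable_EFinP.
  move=> w _; rewrite lee_fin indicE; case: (boolP (w \in _)).
    by rewrite inE mulr1 => -[Aw Nw]; exact: hit.
  by rewrite mulr0; case/andP: (l01 w).
- move=> v alpha c psi1; rewrite -E /reward /discounted_payoff.
  congr (expectation _ (stopped _ _)); apply/funext => t; apply/funext => w.
  by rewrite /exp_process; congr (_ * (_ + _)); ring.
Qed.

End HittingReward.

(** * A Gaussian component makes the process take negative values *)

Section NegativeValues.
Context d (Omega : measurableType d) (R : realType) (P : probability Omega R).

Lemma one_minus_cos_le (y : R) : 0 <= y -> 1 - cos y <= y.
Proof.
move=> y0; have Dcos x : x \in `]0, y[ -> is_derive x 1 cos (- sin x).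
  by move=> _; exact: is_derive_cos.
have Ccos : {within `[0, y], continuous (@cos R)}.
  by apply: continuous_subspaceT => x; exact: continuous_cos.
have [c _] := MVT_segment y0 Dcos Ccos.
rewrite cos0 subr0 => E; have := ler_wpM2r y0 (sin_le1 c).
by rewrite mul1r; lra.
Qed.

Lemma Re_char_fun (Z : Omega -> R) (lambda : R) :
  complex.Re (char_fun P Z lambda) = \int[P]_w cos (lambda * Z w).
Proof.
rewrite /char_fun /Cintegral /=; apply: eq_Rintegral => w _.
by rewrite /cexp /= !(mul0r, mulr0, mul1r, oppr0, addr0, add0r, expR0).
Qed.

(** The drift and the compensator are purely imaginary, and the jumps contribute the integral of
    [1 - cos], which is nonnegative. *)
Lemma Re_levy_exponent_ge (m sigma lambda : R) (Pi : {measure set R -> \bar R}) :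
  sigma ^+ 2 / 2 * lambda ^+ 2 <= complex.Re (levy_exponent m sigma Pi lambda).
Proof.
rewrite /levy_exponent /Cintegral /=.
rewrite !(mul0r, mulr0, mul1r, subr0, oppr0, add0r) lerDl.
rewrite Rintegral_ge0// => x _ /=.
rewrite !(mul0r, mulr0, mul1r, oppr0, addr0, add0r, expR0). rewrite subr_ge0.
exact: cos_le1.
Qed.

Lemma levy_gaussian_decay (X : R -> Omega -> R) (m sigma : R)
    (Pi : {measure set R -> \bar R}) (t lambda : R) :
  has_levy_triplet P X m sigma Pi -> 0 <= t ->
  \int[P]_w cos (lambda * X t w) <= expR (- (t * (sigma ^+ 2 / 2 * lambda ^+ 2))).
Proof.
move=> [_ HX] t0; rewrite -Re_char_fun HX// /cexp.
have := Re_levy_exponent_ge m sigma lambda Pi.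
case: (levy_exponent m sigma Pi lambda) => a b /= ha.
rewrite !(mul0r, mulr0, subr0, addr0).
apply: le_trans (ler_piMr (expR_ge0 _) (cos_le1 _)) _.
by rewrite ler_expR lerN2 ler_wpM2l.
Qed.

(** Integrate [1 - cos y <= y] at [y = lambda * Z w], followed by [Z w <= expR (Z w) - 1]. *)
Lemma one_minus_char_fun_le (Z : Omega -> R) (a lambda : R) :
  measurable_fun setT Z -> (forall w, 0 <= Z w) ->
  (\int[P]_w (expR (Z w))%:E = a%:E)%E -> 0 <= lambda ->
  1 - \int[P]_w cos (lambda * Z w) <= lambda * (a - 1).
Proof.
move=> mZ Z0 Ea lam0.
have mcos : measurable_fun setT (fun w => cos (lambda * Z w)).
  apply: measurableT_comp; first by apply: continuous_measurable_fun; exact: continuous_cos.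
  exact: measurable_funM.
have icos : P.-integrable setT (EFin \o (fun w => cos (lambda * Z w))).
  by apply: (bounded_integrable P mcos (M := 1)) => w; exact: cos_max.
have i1 : P.-integrable setT (EFin \o (fun=> 1 : R)).
  by apply: (bounded_integrable P (M := 1)) => // w; rewrite normr1.
have iexp : P.-integrable setT (EFin \o (fun w => expR (Z w))).
  apply/integrableP; split; first by apply/measurable_EFinP; exact: measurableT_comp.
  under eq_integral do rewrite /= ger0_norm ?expR_ge0//.
  by rewrite Ea ltry.
have P1 : \int[P]_(w in setT) (1 : R) = 1.
  by rewrite Rintegral_cst// mul1r /= probability_setT.
have -> : a = \int[P]_w expR (Z w) by rewrite /Rintegral Ea.
have idiff := integrableB measurableT iexp i1.
have icos1 := integrableB measurableT i1 icos.
rewrite -[X in X - _]P1 -[in leRHS]P1 -!RintegralB// -RintegralZl//.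
apply: le_Rintegral => //; first exact: (integrableZl measurableT lambda idiff).
move=> w _; apply: le_trans (one_minus_cos_le (mulr_ge0 lam0 (Z0 w))) _.
by rewrite ler_wpM2l//; have := expR_ge1Dx (Z w); lra.
Qed.

Lemma levy_nonneg_bound (X : R -> Omega -> R) (psi1 t lambda : R) :
  laplace_exponent1 P X psi1 -> 0 <= t -> 0 <= lambda ->
  measurable_fun setT (X t) -> P [set w | X t w < 0] = 0%E ->
  1 - \int[P]_w cos (lambda * X t w) <= lambda * (expR (t * psi1) - 1).
Proof.
move=> LX t0 lam0 mX X0; set N := [set w | X t w < 0] in X0.
have mN : measurable N.
  have := mX measurableT _ (measurable_itv `]-oo, 0[).
  by rewrite setTI; congr measurable; apply/seteqP; split=> w /=; rewrite in_itv.
(* The positive part is nonnegative everywhere and differs from [X t] only on the null set [N]. *)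
pose Z w := Num.max 0 (X t w).
have ZX w : ~ N w -> Z w = X t w.
  by rewrite /N /= => /negP; rewrite -leNgt => ?; rewrite /Z max_r.
have -> : \int[P]_w cos (lambda * X t w) = \int[P]_w cos (lambda * Z w).
  by congr fine; apply: (integral_eq_off_null mN X0) => w /ZX ->.
apply: one_minus_char_fun_le => //.
- exact: measurable_maxr.
- by move=> w; rewrite /Z le_max lexx.
- have := LX t t0; rewrite expectation.unlock => <-.
  by apply: (integral_eq_off_null mN X0) => w /ZX ->.
Qed.

(* If [X] never went below 0, the two bounds above at [t = 1 / n ^ 2] and
   [lambda = n] would give [1 - exp (- sigma ^ 2 / 2) = O(1 / n)]. *)
Lemma levy_gaussian_negative (X : R -> Omega -> R) (m sigma psi1 : R)
    (Pi : {measure set R -> \bar R}) :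
  has_levy_triplet P X m sigma Pi -> 0 < sigma -> laplace_exponent1 P X psi1 ->
  (forall t, 0 <= t -> measurable_fun setT (X t)) ->
  exists t x : R, [/\ 0 <= t, x < 0 & (0 < P [set w | X t w <= x]%R)%E].
Proof.
move=> HX sigma0 LX mX; apply: contrapT => none.
have X0 t : 0 <= t -> P [set w | X t w < 0] = 0%E.
  move=> t0; have -> : [set w | X t w < 0] =
      \bigcup_n [set w | X t w <= - n.+1%:R^-1].
    apply/seteqP; split=> w /=; last first.
      by move=> [n _ /= ?]; apply: (@le_lt_trans _ _ (- n.+1%:R^-1)) => //; rewrite oppr_lt0.
    rewrite -oppr_gt0 => Xw; pose n := Num.truncn (- X t w)^-1; exists n => //=.
    rewrite -lerN2 opprK ltW// -[ltRHS]invrK ltf_pV2 ?posrE ?invr_gt0//.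
    exact: truncnS_gt.
  apply: (null_bigcup _).2 => n; split.
    have := mX t t0 measurableT _ (measurable_itv `]-oo, - n.+1%:R^-1]).
    by rewrite setTI; congr measurable; apply/seteqP; split=> w /=; rewrite in_itv.
  apply/eqP; rewrite eq_le measure_ge0 andbT leNgt; apply/negP => Pn.
  by apply: none; exists t, (- n.+1%:R^-1); split=> //; rewrite oppr_lt0.
(* With [t = 1 / n ^ 2] and [lambda = n] the Gaussian bound does not depend on [n], which makes [e]
   a fixed positive lower bound. *)
pose e := 1 - expR (- (sigma ^+ 2 / 2)); pose p := 1 + `|psi1|.
have s0 : 0 < sigma ^+ 2 / 2 by rewrite divr_gt0// exprn_gt0.
have e0 : 0 < e by rewrite subr_gt0 -[ltRHS]expR0 ltr_expR oppr_lt0.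
have p1 : 1 <= p by rewrite lerDl.
have key (n : R) : 2 * p <= n -> e <= 2 * p / n.
  move=> pn; have n0 : 0 < n by lra.
  have t0 : 0 <= (n ^+ 2)^-1 by rewrite invr_ge0 exprn_ge0// ltW.
  have := levy_gaussian_decay n HX t0.
  have := levy_nonneg_bound LX t0 (ltW n0) (mX _ t0) (X0 _ t0).
  rewrite [(n ^+ 2)^-1 * (_ * _)]mulrC mulfK ?expf_neq0 ?gt_eqF// => H1 H2.
  have {H1 H2} H : e <= n * (expR ((n ^+ 2)^-1 * psi1) - 1) by rewrite /e; lra.
  apply: (le_trans H); rewrite ler_pdivlMr//.
  pose y := (n ^+ 2)^-1 * p.
  have yn : y * n ^+ 2 = p by rewrite /y mulrAC mulVf ?mul1r// expf_neq0// gt_eqF.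
  have y0 : 0 < y by rewrite /y mulr_gt0 ?invr_gt0 ?exprn_gt0//; lra.
  have y2 : y <= 1 / 2.
    have : y * n ^+ 2 * 2 <= n ^+ 2 by rewrite yn; nra.
    have : 0 < n ^+ 2 by rewrite exprn_gt0.
    by nra.
  have E1 : expR ((n ^+ 2)^-1 * psi1) <= expR y.
    by rewrite ler_expR ler_wpM2l// (le_trans (ler_norm _))// lerDr.
  have E2 : expR y <= 1 + 2 * y.
    (* From [expR y * (1 - y) <= 1], and [(1 + 2 * y) * (1 - y) >= 1] for [y] in [[0, 1 / 2]]. *)
    have := expR_ge1Dx (- y); have := expR_gt0 y; have := expRxMexpNx_1 y.
    by nra.
  have n2 : 0 <= n ^+ 2 by rewrite exprn_ge0// ltW.
  have E3 : expR ((n ^+ 2)^-1 * psi1) - 1 <= 2 * y by lra.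
  by have := ler_wpM2r n2 E3; rewrite -[2 * y * _]mulrA yn expr2; lra.
(* This [n] gives [e * n = 2 * p * e + 4 * p > 2 * p], against [key]. *)
pose n := 2 * p + 4 * p / e.
have pe : 0 < 4 * p / e by rewrite divr_gt0//; lra.
have := key n; rewrite ler_pdivlMr /n; last by lra.
have -> : e * (2 * p + 4 * p / e) = 2 * p * e + 4 * p by field; rewrite gt_eqF.
by have : 0 < p * e by [rewrite mulr_gt0//; lra]; lra.
Qed.

End NegativeValues.

(** * One-sided limits and slopes *)

Section OneSidedCalculus.
Context (R : realType).
Implicit Types (G L : R -> R).

(** The inequality [1 + x <= expR x], used at [h] and at [- h], squeezes the quotient between
    [- (1 + h)^-1] and [-1]. *)
Lemma expRN_left_quotient : (expR (- h) - 1) / h @[h --> 0^'-] --> (-1 : R).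
Proof.
apply: (@squeeze_cvgr _ _ _ _ (fun h : R => - (1 + h)^-1) (fun=> -1)).
- near=> h; have h0 : h < 0 by near: h; exact: nbhs_left_lt.
  have h1 : - 1 < h by near: h; apply: nbhs_left_gt; rewrite ltrN10.
  have p : 0 < 1 + h by lra.
  apply/andP; split; last first.
    by rewrite ler_ndivrMr// mulN1r; have := expR_ge1Dx (- h); lra.
  rewrite ler_ndivlMr//; have E1 := expR_ge1Dx h.
  have : expR (- h) <= (1 + h)^-1 by rewrite expRN lef_pV2 ?posrE ?expR_gt0.
  have : (1 + h)^-1 * (1 + h) = 1 by rewrite mulVf// gt_eqF.
  by lra.
- have -> : (-1 : R) = - (1 + 0)^-1 by rewrite addr0 invr1.
  apply: cvgN; apply: cvgV; first by rewrite addr0 oner_neq0.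
  apply: cvgD; first exact: cvg_cst.
  exact: cvg_at_left_filter cvg_id.
- exact: cvg_cst.
Unshelve. all: by end_near. Qed.

Lemma expRN_left_cvg : expR (- h) @[h --> 0^'-] --> (1 : R).
Proof.
apply: cvg_at_left_filter; have -> : (1 : R) = expR (- 0) by rewrite oppr0 expR0.
apply: continuous_comp; first exact: opp_continuous.
exact: continuous_expR.
Qed.

Lemma left_derivativeE (f : R -> R) l : f 0 = 1 -> is_left_derivative f 0 l ->
  (f h - 1) / h @[h --> 0^'-] --> l.
Proof. by move=> f0; rewrite /is_left_derivative f0; under eq_fun do rewrite add0r. Qed.

(* For [v = b e^{-h}] the quotient of the smooth-fit defect
   [g(v, b) - (c/r - a v)] by [h], where [a = alpha / (r - psi1)]. *)
Lemma fit_defect_cvg G L (a K b dG dL : R) : G 0 = 1 -> L 0 = 1 ->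
  is_left_derivative G 0 dG -> is_left_derivative L 0 dL ->
  (a * (b * expR (- h)) * (1 - G h) - K * (1 - L h)) / h @[h --> 0^'-]
    --> K * dL - a * b * dG.
Proof.
move=> G0 L0 /(left_derivativeE G0) HG /(left_derivativeE L0) HL.
rewrite (_ : (fun h => _) = fun h => K * ((L h - 1) / h)
    - a * b * expR (- h) * ((G h - 1) / h)); last by apply/funext => h; ring.
apply: cvgB; first exact: cvgM (cvg_cst _) HL.
rewrite -[X in X * dG]mulr1.
by apply: cvgM HG; apply: cvgM expRN_left_cvg; exact: cvg_cst.
Qed.

(** Convexity enters through supporting lines: for [B < v <= w], the line at [v] separates the
    slopes on either side of [v], so slopes from [B] grow with the endpoint. As [h] increases to 0
    the endpoint decreases to [B], and the slopes decrease while bounded below by [M]. *)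
Lemma convex_right_slope_cvg (s : R -> R) (B M : R) : 0 < B ->
  (forall v, 0 < v -> exists m, forall u, 0 < u -> s v + m * (u - v) <= s u) ->
  (forall v, B < v -> M <= (s v - s B) / (v - B)) ->
  cvg ((s (B * expR (- h)) - s B) / (B * expR (- h) - B) @[h --> 0^'-]).
Proof.
move=> B0 supp lb; set q := fun h => _.
have Bh h : h < 0 -> B < B * expR (- h).
  by move=> h0; rewrite ltr_pMr// -expR0 ltr_expR oppr_gt0.
rewrite -[q]opprK; apply: is_cvgN.
apply: nondecreasing_at_left_is_cvgr.
- near=> x => h k; rewrite !in_itv/= => /andP[_ h0] /andP[_ k0] hk.
  rewrite /= lerN2 /q; set v := B * expR (- k); set w := B * expR (- h).
  have Bv : B < v by exact: Bh.
  have vw : v <= w by rewrite ler_pM2l// ler_expR lerN2.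
  have [m sm] := supp v (lt_trans B0 Bv).
  have := sm B B0; have := sm w (lt_le_trans (lt_trans B0 Bv) vw) => H1 H2.
  rewrite ler_pdivrMr ?subr_gt0// mulrAC ler_pdivlMr ?subr_gt0; last first.
    exact: lt_le_trans Bv vw.
  have vB : 0 < v - B by rewrite subr_gt0.
  have Hm : s v - s B <= m * (v - B) by lra.
  have wv : 0 <= w - v by rewrite subr_ge0.
  have H3 : (s v - s B) * (w - v) <= m * (w - v) * (v - B) by nra.
  have H4 : m * (w - v) * (v - B) <= (s w - s v) * (v - B).
    by apply: ler_wpM2r; [exact: ltW|lra].
  by lra.
- near=> x; exists (- M) => _ [y /= + <-]; rewrite in_itv/= => /andP[_ y0].
  by rewrite lerN2; apply: lb; exact: Bh.
Unshelve. all: by end_near. Qed.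

End OneSidedCalculus.

(** * Deterministic analysis of the optimal threshold *)

Section SmoothFit.
Context (R : realType) (G L : R -> R) (a K B : R).

(* The value [g(v, b)] of the threshold [b] at [v], up to the constants
   [a = alpha / (r - psi1)] and [K = c / r]. *)
Definition threshold_value (b v : R) : R :=
  - (a * v * G (ln (b / v))) + K * L (ln (b / v)).

Hypotheses (a0 : 0 < a) (K0 : 0 < K) (B0 : 0 < B).
Hypothesis GL : forall x, 0 <= G x <= expR x * L x.
Hypothesis L01 : forall x, 0 <= L x <= 1.
Hypothesis GL0 : forall x, 0 <= x -> L x = 1 /\ G x = 1.
Hypothesis opt : forall v x, 0 < v ->
  - (a * v * G x) + K * L x <= threshold_value B v.

Local Notation s := (threshold_value B).

(** The competitor of level [x = 0] stops at once. *)
Lemma value_ge_payoff v : 0 < v -> K - a * v <= s v.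
Proof. by move=> v0; have := opt 0 v0; have [-> ->] := GL0 (lexx 0); lra. Qed.

Lemma threshold_value_stop b v : 0 < v -> v <= b -> threshold_value b v = K - a * v.
Proof.
move=> v0 vb; rewrite /threshold_value; have [|-> ->] := @GL0 (ln (b / v)).
  by rewrite ln_ge0// ler_pdivlMr// mul1r.
by ring.
Qed.

(** The substitution [v = b * expR (- h)] turns [ln (b / v)] into [h]: [v] decreasing to [b] is [h]
    increasing to 0. *)
Lemma threshold_value_scaled b h : 0 < b ->
  threshold_value b (b * expR (- h)) = - (a * (b * expR (- h)) * G h) + K * L h.
Proof.
move=> b0; rewrite /threshold_value.
suff -> : b / (b * expR (- h)) = expR h by rewrite expRK.
by rewrite expRN invfM invrK mulrA divff ?mul1r// gt_eqF.
Qed.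

(* [s] is a supremum of affine functions of [v], hence convex. *)
Lemma value_support v : 0 < v ->
  exists m, forall u, 0 < u -> s v + m * (u - v) <= s u.
Proof.
move=> v0; exists (- (a * G (ln (B / v)))) => u u0.
apply: le_trans (opt (ln (B / v)) u0); rewrite {1}/threshold_value.
by rewrite le_eqVlt; apply/orP; left; apply/eqP; ring.
Qed.

Lemma left_derivative_of_value dG : is_left_derivative G 0 dG ->
  exists dL, is_left_derivative L 0 dL.
Proof.
have [L0 G0] := GL0 (lexx 0).
move=> /(left_derivativeE G0) HG.
have sB : s B = K - a * B by exact: threshold_value_stop.
have /cvg_ex[/= q Hq] : cvg ((s (B * expR (- h)) - s B) / (B * expR (- h) - B)
    @[h --> 0^'-]).
  (* The slope bound is [- a] because [s] lies above the payoff [K - a * v] and meets it at [B]. *)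
  apply: (@convex_right_slope_cvg _ _ _ (- a)) => // [v v0|v Bv].
    exact: value_support.
  rewrite ler_pdivlMr ?subr_gt0// sB.
  by have := value_ge_payoff (lt_trans B0 Bv); lra.
pose E h : R := (expR (- h) - 1) / h.
(* Solving [s v = - (a * v * G h) + K * L h] for [(L h - 1) / h] leaves the slope of [s], the
   quotient of [G] and [E]; the witness is the limit of that expression. *)
exists (K^-1 * (q * (B * -1) + (a * B * 1 * dG + a * B * -1))).
rewrite /is_left_derivative L0.
apply: (@cvg_trans _ ((K^-1 * ((s (B * expR (- h)) - s B) / (B * expR (- h) - B)
    * (B * E h) + (a * B * expR (- h) * ((G h - 1) / h) + a * B * E h)))
    @[h --> 0^'-])).
  apply: near_eq_cvg; near=> h; have h0 : h < 0 by near: h; exact: nbhs_left_lt.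
  rewrite add0r sB threshold_value_scaled// /E.
  have e1 : expR (- h) - 1 != 0.
    by rewrite subr_eq0 gt_eqF// -expR0 ltr_expR oppr_gt0.
  field; apply/and3P; split; [by rewrite lt_eqF| |by rewrite gt_eqF].
  by rewrite -[X in _ - X]mulr1 -mulrBr mulf_neq0// gt_eqF.
apply: cvgM; first exact: cvg_cst.
have HE0 : E h @[h --> 0^'-] --> (-1 : R) by exact: (@expRN_left_quotient R).
have HE : (B * E h) @[h --> 0^'-] --> B * -1.
  by apply: cvgM HE0; exact: cvg_cst.
apply: cvgD; first exact: cvgM Hq HE.
apply: cvgD.
  have He : (a * B * expR (- h)) @[h --> 0^'-] --> a * B * 1.
    refine (cvgM _ (@expRN_left_cvg R)); exact: cvg_cst.
  exact: cvgM He HG.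
by apply: cvgM HE0; exact: cvg_cst.
Unshelve. all: by end_near. Qed.

(** For [h < 0], [G h <= expR h * L h <= 1 = G 0]. *)
Lemma left_derivative_ge0 dG : is_left_derivative G 0 dG -> 0 <= dG.
Proof.
have [_ G0] := GL0 (lexx 0) => /(left_derivativeE G0) HG.
rewrite -(cvg_lim _ HG)//; apply: limr_ge; first exact: cvgP HG.
near=> h; have h0 : h < 0 by near: h; exact: nbhs_left_lt.
rewrite ler_ndivlMr// mul0r subr_le0.
have /andP[_ Gh] := GL h; have /andP[_ Lh] := L01 h; apply: le_trans Gh _.
have : expR h <= 1 by rewrite -expR0 ler_expR ltW.
by have := expR_gt0 h; nra.
Unshelve. all: by end_near. Qed.

(** The excess of [s] over the payoff to the right of [B] is nonnegative; divided by [h < 0] it is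
    nonpositive, and so is its limit. *)
Lemma fit_inequality dG dL : is_left_derivative G 0 dG ->
  is_left_derivative L 0 dL -> K * dL <= a * B * dG.
Proof.
have [L0 G0] := GL0 (lexx 0) => HG HL.
have HD := @fit_defect_cvg _ G L a K B _ _ G0 L0 HG HL.
rewrite -subr_le0 -(cvg_lim _ HD)//; apply: limr_le; first exact: cvgP HD.
near=> h; have h0 : h < 0 by near: h; exact: nbhs_left_lt.
rewrite ler_ndivrMr// mul0r.
have := value_ge_payoff (mulr_gt0 B0 (expR_gt0 (- h))).
by rewrite threshold_value_scaled//; lra.
Unshelve. all: by end_near. Qed.

(** Otherwise stopping at [B] pays at most 0, whereas waiting for a lower level, reached with
    positive probability, pays more. *)
Lemma threshold_lt x : x < 0 -> 0 < L x -> B < K / a.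
Proof.
move=> x0 Lx; rewrite ltNge; apply/negP; rewrite ler_pdivrMr// => KB.
have aB : 0 < a * B by rewrite mulr_gt0.
have sB : s B = K - a * B by exact: threshold_value_stop.
have low y : L y * (K - a * B * expR y) <= K - a * B.
  rewrite -sB; apply: le_trans (opt y B0); have /andP[_ Gy] := GL y.
  have : a * B * G y <= a * B * (expR y * L y) by rewrite ler_pM2l.
  by lra.
have : K = a * B.
  apply/eqP; rewrite eq_le mulrC KB/= mulrC.
  (* At this level the payoff vanishes, so [low] gives [0 <= K - a * B]; hence equality, and the
     level [x] then yields a positive reward. *)
  have := low (ln (K / (a * B))); rewrite lnK ?posrE ?divr_gt0//.
  by rewrite mulrCA mulfV ?mulr1 ?gt_eqF// subrr mulr0 subr_ge0.
move=> E; have := low x; rewrite -E subrr -{1}[K]mulr1 -mulrBr.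
rewrite leNgt => /negP; apply; rewrite !mulr_gt0// subr_gt0.
by rewrite -expR0 ltr_expR.
Qed.

(* The defect [D = g(., b) - payoff] is nonpositive on ]b, B[ by optimality of
   [B] and strictly convex, hence bounded above by a linear function of
   negative slope near [b], whereas smooth fit forces slope [0]. *)
Lemma strictly_convex_no_gap dG dL b : is_left_derivative G 0 dG ->
  is_left_derivative L 0 dL -> 0 < b -> b < B -> K * dL = a * b * dG ->
  strictly_convex_on [set v | b < v] (threshold_value b) -> False.
Proof.
have [L0 G0] := GL0 (lexx 0) => HG HL b0 bB fit cvx.
have HD := @fit_defect_cvg _ G L a K b _ _ G0 L0 HG HL.
rewrite fit subrr in HD.
pose D v := threshold_value b v - (K - a * v).
have Dle v : b < v -> v < B -> D v <= 0.
  move=> bv vB; have v0 := lt_trans b0 bv.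
  rewrite subr_le0 -(threshold_value_stop v0 (ltW vB)); exact: opt.
have Dcvx x y t : b < x -> b < y -> x != y -> 0 < t -> t < 1 ->
    D (t * x + (1 - t) * y) < t * D x + (1 - t) * D y.
  by move=> bx yb xy t0 t1; have := cvx x y t bx yb xy t0 t1; rewrite /D; lra.
(* Two distinct points of the gap, where [D <= 0]: at their midpoint [w] strict convexity gives
   [D w < 0]. *)
pose p := b + (B - b) / 4; pose q := b + (B - b) / 2; pose w := 1/2 * p + (1 - 1/2) * q.
have Dw : D w < 0.
  have Dp : D p <= 0 by apply: Dle; rewrite /p; lra.
  have Dq : D q <= 0 by apply: Dle; rewrite /q; lra.
  have := @Dcvx p q (1/2); rewrite -/w => H; have : D w < 1/2 * D p + (1 - 1/2) * D q.
    by apply: H; [rewrite /p; lra|rewrite /q; lra|rewrite lt_eqF// /p /q; lra|lra|lra].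
  by lra.
have bw : b < w by rewrite /w /p /q; lra.
have wB : w < B by rewrite /w /p /q; lra.
pose delta := - D w / (2 * (w - b)).
have delta0 : 0 < delta by rewrite divr_gt0// ?oppr_gt0//; lra.
have Dlin u : b < u -> u < w -> D u <= - delta * (u - b).
  (* Convexity is known only to the right of [b], so the chord to [w] starts from the midpoint [z]
     of [b] and [u]. This halves the slope, whence the 2 in [delta]. *)
  move=> bu uw; pose z := (b + u) / 2; pose t := (u - z) / (w - z).
  have wz : 0 < w - z by rewrite /z; lra.
  have t0 : 0 < t by rewrite divr_gt0// /z; lra.
  have t1 : t < 1 by rewrite ltr_pdivrMr// /z; lra.
  have uE : u = t * w + (1 - t) * z.
    by rewrite /t; field; rewrite gt_eqF.
  have Du : D u <= t * D w.
    have := @Dcvx w z t bw _ _ t0 t1; rewrite -uE => H.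
    have /H : b < z by rewrite /z; lra.
    have zw : w != z by rewrite gt_eqF// /z; lra.
    move=> /(_ zw); have : D z <= 0 by apply: Dle; rewrite /z; lra.
    by nra.
  apply: (le_trans Du).
  have tge : (u - b) / (2 * (w - b)) <= t.
    rewrite /t ler_pdivlMr// mulrAC ler_pdivrMr; last by lra.
    by rewrite /z; nra.
  have -> : - delta * (u - b) = (u - b) / (2 * (w - b)) * D w.
    by rewrite /delta; field; rewrite gt_eqF// subr_gt0.
  by rewrite ler_nM2r.
(* Since [u - b >= - b * h] for [u = b * expR (- h)], every quotient [D u / h] is at least
   [delta * b], while smooth fit makes the limit 0. *)
have : delta * b <= 0.
  rewrite -(cvg_lim _ HD)//; apply: limr_ge; first exact: cvgP HD.
  near=> h; have h0 : h < 0 by near: h; exact: nbhs_left_lt.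
  have bu : b < b * expR (- h) by rewrite ltr_pMr// -expR0 ltr_expR oppr_gt0.
  have uw : b * expR (- h) < w.
    near: h; have HB : (b * expR (- h)) @[h --> 0^'-] --> b * 1.
      by apply: cvgM (@expRN_left_cvg R); exact: cvg_cst.
    by apply: (cvgr_lt _ HB); rewrite mulr1.
  have := Dlin _ bu uw; rewrite /D threshold_value_scaled// => H.
  rewrite ler_ndivlMr//.
  have e1 := expR_ge1Dx (- h).
  have e2 : delta * (b * (- h)) <= delta * (b * expR (- h) - b).
    by rewrite ler_pM2l//; nra.
  by lra.
by rewrite leNgt mulr_gt0.
Unshelve. all: by end_near. Qed.

End SmoothFit.

(** * Degenerate thresholds and the role of the starting value *)

Section ThresholdReward.
Context d (Omega : measurableType d) (R : realType) (P : probability Omega R).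

Lemma threshold_reward_nonpos (X : R -> Omega -> R) (r alpha c psi1 v b : R) :
  0 < v -> b <= 0 -> threshold_reward P r alpha c psi1 X v b = 0.
Proof.
move=> v0 b0; rewrite /threshold_reward /reward.
have -> : stopped (discounted_payoff r alpha c psi1 (exp_process X v))
    (hitting_time (exp_process X v) b) = cst 0.
  apply/funext => w; rewrite /stopped /hitting_time.
  rewrite (_ : [set _ | _ in _] = set0) ?ereal_inf0//.
  apply/seteqP; split=> // _ [t /= [_ Vb] _].
  by have := mulr_gt0 v0 (expR_gt0 (X t w)); move: Vb; rewrite /exp_process; lra.
by rewrite expectation_cst.
Qed.

(** A threshold [b <= 0] is never reached, and the resulting zero reward is not strictly convex. *)
Lemma strictly_convex_threshold_gt0 (X : R -> Omega -> R)
    (r alpha c psi1 b : R) :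
  strictly_convex_on [set v | b < v]
    (fun v => threshold_reward P r alpha c psi1 X v b) -> 0 < b.
Proof.
move=> cvx; rewrite ltNge; apply/negP => b0.
have := cvx 1 2 (1 / 2); rewrite !threshold_reward_nonpos//; try lra.
rewrite !mulr0 addr0 ltxx => H; suff : false by [].
by apply: H => /=; rewrite ?lt_eqF//; lra.
Qed.

Lemma sub_generated_filtration_exp_process (X : R -> Omega -> R) (v u t : R) :
  u != 0 -> generated_filtration (exp_process X v) t `<=`
            generated_filtration (exp_process X u) t.
Proof.
move=> u0; apply: sub_sigma_algebra2 => _ [s [B [s0 st mB ->]]].
exists s, ((fun y : R => v / u * y) @^-1` B); split=> //.
  by rewrite -[X in measurable X]setTI; exact: mulrl_measurable.
apply/seteqP; split=> w /=; rewrite /exp_process;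
  suff -> : v / u * (u * expR (X s w)) = v * expR (X s w) by [].
  by rewrite mulrA divfK.
by rewrite mulrA divfK.
Qed.

(** Changing the starting value rescales the process by a nonzero constant, which keeps the
    generated sigma-algebras. A stopping time known for one starting value thus competes at all
    others. *)
Lemma Delta_exp_process (X : R -> Omega -> R) (v u : R) :
  v != 0 -> u != 0 -> Delta P (exp_process X v) = Delta P (exp_process X u).
Proof.
move=> v0 u0; rewrite /Delta (_ : usual_filtration _ _ =
  usual_filtration P (exp_process X u))//.
apply/funext => t; rewrite /usual_filtration; apply: eq_bigcapr => s _.
congr (<<s _ `|` _ >>); apply/seteqP.
by split; exact: sub_generated_filtration_exp_process.
Qed.

End ThresholdReward.

(** * Existence of the derivative, bounds on the threshold, and its identification *)

Theorem theorem3p14 (R : realType) (d : measure_display)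
    (Omega : measurableType d) (P : probability Omega R)
    (F : R -> set (set Omega)) (X : R -> Omega -> R)
    (m sigma : R) (Pi : {measure set R -> \bar R})
    (psi1 r alpha c Bc : R) :
  filtration F ->
  levy_process P F X ->
  has_levy_triplet P X m sigma Pi ->
  0 < r -> 0 < alpha -> 0 < c ->
  0 < sigma ->
  (forall v t : R, 0 < v -> 0 <= t -> ('E_P[exp_process X v t] < +oo)%E) ->
  laplace_exponent1 P X psi1 ->
  psi1 < r ->
  (forall v : R, 0 < v ->
     class_D P (exp_process X v)
       (discounted_payoff r alpha c psi1 (exp_process X v))) ->
  optimal_threshold P r alpha c psi1 X Bc ->
  {for 0, continuous (calG P r X)} ->
  forall dG : R, is_left_derivative (calG P r X) 0 dG ->
    (exists dL : R, is_left_derivative (calL P r X) 0 dL) /\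
    (dG != 0 ->
       let bt := btilde P r alpha c psi1 X in
       (cvg ((1 - calL P r X x) / (1 - calG P r X x) @[x --> 0^'-]) /\
        bt <= Bc /\ Bc < (r - psi1) * c / (r * alpha)) /\
       (strictly_convex_on [set v | bt < v]
            (fun v => threshold_reward P r alpha c psi1 X v bt) ->
        Bc = bt /\
        forall v : R, 0 < v ->
          smallest_optimal P r alpha c psi1 (exp_process X v)
            (hitting_time (exp_process X v) bt))).
Proof.
Proof.
move=> FF LX HX r0 alpha0 c0 sigma0 _ Lpsi psi1r _ [Bc0 Bopt] _ dG HG.
have mX := levy_process_measurable FF LX.
have Xreg := levy_process_regular LX.
have k0 : 0 < r - psi1 by rewrite subr_gt0.
pose a := alpha / (r - psi1); pose K := c / r.
have a0 : 0 < a by exact: divr_gt0.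
have K0 : 0 < K by exact: divr_gt0.
(* Each hitting time of [X] is the optimal time for the starting value [Bc * expR (- x)], hence a
   stopping time; its measurability and its membership in [Delta] both come from this. *)
have hitE x : hitting_time X x =
    hitting_time (exp_process X (Bc * expR (- x))) Bc.
  rewrite hitting_time_exp_process ?mulr_gt0 ?expR_gt0//.
  by rewrite expRN invfM invrK mulrA divff ?mul1r ?expRK// gt_eqF.
have mtau x t : ae_measurable P [set w | (hitting_time X x w <= t%:E)%E].
  have v0 : 0 < Bc * expR (- x) by rewrite mulr_gt0// expR_gt0.
  have [t0|t0] := leP 0 t; last first.
    rewrite (_ : [set w | _] = set0); first by case: (sigma_algebra_ae_measurable P).
    apply/seteqP; split=> // w /= /(le_trans (hitting_time_ge0 _ _ _)).
    by rewrite lee_fin leNgt t0.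
  have [[[_ st] _] _] := Bopt _ v0.
  have := st t t0; rewrite -hitE.
  apply: usual_filtration_ae_measurable => // s s0.
  by apply: measurable_funM => //; apply: measurableT_comp => //; exact: mX.
have HR x := hitting_reward r0 mX Xreg (mtau x).
set G := calG P r X in HG *; set L := calL P r X.
have L01 x : 0 <= L x <= 1 by have [] := HR x.
have GL x : 0 <= G x <= expR x * L x by have [] := HR x.
have GL0 x : 0 <= x -> L x = 1 /\ G x = 1 by have [] := HR x.
have rew v x : reward P r alpha c psi1 (exp_process X v) (hitting_time X x) =
    (- (a * v * G x) + K * L x)%:E.
  by have [_ _ _ _ ->] := HR x; rewrite /a /K -/G -/L; congr EFin; field; rewrite !gt_eqF.
have trew b v : 0 < b -> 0 < v ->
    threshold_reward P r alpha c psi1 X v b = threshold_value G L a K b v.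
  by move=> b0 v0; rewrite /threshold_reward hitting_time_exp_process// rew.
have inDelta v x : 0 < v -> Delta P (exp_process X v) (hitting_time X x).
  move=> v0; have u0 : 0 < Bc * expR (- x) by rewrite mulr_gt0// expR_gt0.
  rewrite (@Delta_exp_process _ _ _ P X v (Bc * expR (- x))) ?gt_eqF//.
  by rewrite hitE; have [[]] := Bopt _ u0.
have opt v x : 0 < v -> - (a * v * G x) + K * L x <= threshold_value G L a K Bc v.
  move=> v0; rewrite -lee_fin -rew /threshold_value -rew.
  rewrite -hitting_time_exp_process//; have [[_ ->] _] := Bopt _ v0.
  by apply: ereal_sup_ubound; exists (hitting_time X x) => //; exact: inDelta.
have [L0 G0] := GL0 0 (lexx 0).
have [dL HL] := left_derivative_of_value K0 Bc0 GL0 opt HG.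
split; first by exists dL.
move=> dG0 bt.
have dGp : 0 < dG by rewrite lt_def dG0 (left_derivative_ge0 GL L01 GL0 HG).
(* Divide numerator and denominator by [h]; [dG] is nonzero. *)
have ratio : ((1 - L h) / (1 - G h)) @[h --> 0^'-] --> dL / dG.
  have HLG : ((L h - 1) / h) / ((G h - 1) / h) @[h --> 0^'-] --> dL / dG.
    apply: cvgM (left_derivativeE L0 HL) _.
    exact: cvgV dG0 (left_derivativeE G0 HG).
  apply: cvg_trans HLG; apply: near_eq_cvg; near=> h.
  have h0 : h < 0 by near: h; exact: nbhs_left_lt.
  rewrite -[1 - L h]opprB -[1 - G h]opprB invrN mulrNN invfM invrK.
  by rewrite mulrACA [h^-1 * h]mulVf ?lt_eqF// mulr1.
have KE : (r - psi1) * c / (r * alpha) = K / a.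
  by rewrite /K /a; field; rewrite !gt_eqF.
have btE : bt = K / a * (dL / dG).
  by rewrite /bt /btilde (cvg_lim _ ratio)// KE.
(* The smooth-fit equation at [bt]; compared with [fit_inequality] at [Bc], it gives [bt <= Bc]
   after division by [a * dG > 0]. *)
have fit : K * dL = a * bt * dG by rewrite btE; field; rewrite !gt_eqF.
have btBc : bt <= Bc.
  have := fit_inequality Bc0 GL0 opt HG HL.
  by rewrite fit ler_pM2r// ler_pM2l.
split.
  split; first by apply/cvg_ex; exists (dL / dG).
  split=> //; rewrite KE.
  have [t [x [t0 x0 Px]]] := levy_gaussian_negative HX sigma0 Lpsi mX.
  have Lx : 0 < L x by have [_ _ _ H _] := HR x; exact: H Px.
  exact: (threshold_lt a0 K0 Bc0 GL GL0 opt x0 Lx).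
move=> cvx; have bt0 := strictly_convex_threshold_gt0 cvx.
have BE : Bc = bt.
  apply/eqP; rewrite eq_le btBc andbT leNgt; apply/negP => btlt.
  apply: (strictly_convex_no_gap GL0 opt HG HL bt0 btlt fit).
  move=> x y t bx by_ xy t0 t1; have := cvx x y t bx by_ xy t0 t1.
  have xp : 0 < x by exact: lt_trans bx.
  have yp : 0 < y by exact: lt_trans by_.
  by rewrite !trew//; nra.
by split=> // v v0; rewrite -BE; exact: Bopt.
Unshelve. all: by end_near. Qed.
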